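(* Let $x(t)=\sum_{k=1}^K A_k(t)e^{i2\pi\phi_k(t)}\in\mathcal{E}_{\epsilon_1,\epsilon_3}$ for some $\epsilon_1>0,\epsilon_3>0$, and let $U_x(a,b,\lambda)$ be the adaptive time-scale-chirp_rate transform (TSC-R) of $x$ with an admissible window function $g$, with associated constant $c_0$ and functions $\beta,\gamma$. Suppose that for some $0<\Delta<1$ and $\Delta_1>0$, for any $k\neq\ell$, either $$\frac{|\phi_k'(t)-\phi_\ell'(t)|}{\phi_k'(t)+\phi_\ell'(t)}\ge\Delta \ \text{ for all } t\in\mathbb{R},\qquad\text{or}\qquad |\phi_k''(t)-\phi_\ell''(t)|\ge 2\Delta_1\ \text{ for all } t\in\mathbb{R},$$ that $2M(b)\big(\Upsilon(b)+\Pi_0(b)\big)\le\nu(b)$, and that $2\,\mathrm{Err}_\ell(b)/A_\ell(b)\le c_0$ for $1\le\ell\le K$. Let $\mathcal{H}_b$ and $\mathcal{H}_{b,k}$ be the sets defined in the context with some $\widetilde\epsilon_1=\widetilde\epsilon_1(b)>0$ satisfying $$M(b)\big(\Upsilon(b)+\Pi_0(b)\big)\le\widetilde\epsilon_1\le\nu(b)-M(b)\big(\Upsilon(b)+\Pi_0(b)\big),$$ and let $(\widehat a_\ell,\widehat\lambda_\ell)=(\widehat a_\ell(b),\widehat\lambda_\ell(b))=\mathrm{argmax}_{(a,\lambda)\in\mathcal{H}_{b,\ell}}|U_x(a,b,\lambda)|$, $\ell=1,\dots,K$. Then: (a) For $\ell=1,\dots,K$, $$|\mu-\widehat a_\ell(b)\phi_\ell'(b)|\le\mathrm{Bd}_{1,\ell}:=\frac1{\sigma(b)}\beta^{-1}\Big(1-\frac{2\,\mathrm{Err}_\ell(b)}{A_\ell(b)}\Big),$$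 $$|\widehat\lambda_\ell(b)-\phi_\ell''(b)|\le\mathrm{Bd}_{2,\ell}:=\frac1{\sigma^2(b)\,\widehat a_\ell^{\,2}}\gamma^{-1}\Big(1-\frac{2\,\mathrm{Err}_\ell(b)}{A_\ell(b)}\Big).$$ (b) For $\ell=1,\dots,K$, $\big|U_x(\widehat a_\ell,b,\widehat\lambda_\ell)-x_\ell(b)\big|\le\mathrm{Bd}_{3,\ell}$, where $$\mathrm{Bd}_{3,\ell}:=\mathrm{Err}_\ell(b)+2\pi I_1A_\ell(b)\,\beta^{-1}\Big(1-\frac{2\,\mathrm{Err}_\ell(b)}{A_\ell(b)}\Big)+\pi I_2A_\ell(b)\,\gamma^{-1}\Big(1-\frac{2\,\mathrm{Err}_\ell(b)}{A_\ell(b)}\Big).$$ (c) If, in addition, $g(t)\ge0$ for $t\in\mathbb{R}$, then for $\ell=1,\dots,K$, $\big||U_x(\widehat a_\ell,b,\widehat\lambda_\ell)|-A_\ell(b)\big|\le\mathrm{Err}_\ell(b)$.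
   Context: Signal class: for $\epsilon_1,\epsilon_3>0$, $\mathcal{E}_{\epsilon_1,\epsilon_3}$ is the set of signals $x(t)=\sum_{k=1}^K x_k(t)$, $x_k(t)=A_k(t)e^{i2\pi\phi_k(t)}$, with $A_k\in L_\infty(\mathbb{R})$, $A_k(t)>0$, $\phi_k\in C^3(\mathbb{R})$, $\inf_b\phi_k'(b)>0$, $\sup_b\phi_k'(b)<\infty$, $|A_k(t+\tau)-A_k(t)|\le\epsilon_1|\tau|A_k(t)$ and $|\phi_k'''(t)|\le\epsilon_3$ for all $t,\tau\in\mathbb{R}$ and $1\le k\le K$. Window functions $g\in L_1(\mathbb{R})\cap L_2(\mathbb{R})$ decay to zero at $\infty$ and satisfy $\int_{\mathbb{R}}g(t)\,dt=1$. $\mu>0$ is a constant and $\sigma(b)$ is a positive function of $b$. The adaptive TSC-R is $$U_x(a,b,\lambda)=\int_{\mathbb{R}}x(b+at)\frac1{\sigma(b)}g\Big(\frac t{\sigma(b)}\Big)e^{-i2\pi\mu t-i\pi\lambda a^2t^2}\,dt,$$ with $b,\lambda\in\mathbb{R}$ and scale $a$. Throughout, for each $b$ all scales $a$ lie in an interval $a_1(b)\le a\le a_2(b)$, with $0<a_1(b)\le a_2(b)<\infty$. In particular the scales occurring in the sets $Z_k$ below lie in it: for all $k$ and $b$, every $a>0$ with $|\mu-a\phi_k'(b)|<\Delta$ lies in $[a_1(b),a_2(b)]$. Polynomial Fourier transform: $\breve g(\eta,\lambda)=\int_{\mathbb{R}}g(t)e^{-i2\pi\eta t-i\pi\lambda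 t^2}dt$. Admissible window: a window function $g$ is admissible if (i) $|\breve g(\eta,\lambda)|=f(|\eta|,|\lambda|)$ for some function $f(\xi_1,\xi_2)$ defined on $0\le\xi_1,\xi_2<\infty$; and (ii) there exist $c_0$ with $0<c_0<1$ and strictly decreasing non-negative continuous functions $\beta,\gamma$ on $[0,\infty)$ with $\beta(0)=\gamma(0)=1$ such that whenever $1-c\le f(\eta,\lambda)$ for some $c$ with $0\le c\le c_0$ and some $\eta,\lambda\ge 0$, then $1-c\le\beta(\eta)$ and $1-c\le\gamma(\lambda)$. $\beta^{-1},\gamma^{-1}$ denote the inverse functions. $\nu(b)=\min_{1\le k\le K}A_k(b)$, $M(b)=\sum_{k=1}^KA_k(b)$, $I_n=\int_{\mathbb{R}}|g(t)t^n|dt$, $$\Pi_0(b)=\epsilon_1I_1\sigma(b)a_2(b)+\frac\pi3\epsilon_3I_3\sigma^3(b)a_2(b)^3,\qquad \Pi_\ell(b)=\epsilon_1I_1\sigma(b)\frac{\mu+\Delta}{\phi_\ell'(b)}+\frac\pi3\epsilon_3I_3\sigma^3(b)\Big(\frac{\mu+\Delta}{\phi_\ell'(b)}\Big)^3\ (1\le\ell\le K).$$ $Z_k=\{(a,b,\lambda):|\mu-a\phi_k'(b)|<\Delta\ \text{and}\ |\lambda-\phi_k''(b)|<\Delta_1,\ b\in\mathbb{R}\}$. $\Upsilon(b)$ and $\Upsilon_{\ell,k}(b)$ ($k\ne\ell$) are functions with $\Upsilon(b)\ge\Upsilon_{\ell,k}(b)$ such that, writing $G_k(a,b,\lambda)=\big|\breve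 g\big(\sigma(b)(\mu-a\phi_k'(b)),\ \sigma^2(b)a^2(\lambda-\phi_k''(b))\big)\big|$, $$\sup_{\{(a,\lambda):(a,b,\lambda)\notin\bigcup_{j=1}^KZ_j\}}G_k(a,b,\lambda)\le\Upsilon(b)\ (1\le k\le K),\qquad \sup_{\{(a,\lambda):(a,b,\lambda)\in Z_\ell\}}G_k(a,b,\lambda)\le\Upsilon_{\ell,k}(b)\ (k\ne\ell).$$ $\mathrm{Err}_\ell(b)=M(b)\Pi_\ell(b)+\sum_{k\ne\ell}A_k(b)\Upsilon_{\ell,k}(b)$, the sum being over $1\le k\le K$, $k\neq \ell$. $\mathcal{H}_b=\{(a,\lambda):|U_x(a,b,\lambda)|>\widetilde\epsilon_1\}$ and $\mathcal{H}_{b,k}=\{(a,\lambda)\in\mathcal{H}_b:|\mu-a\phi_k'(b)|<\Delta\ \text{and}\ |\lambda-\phi_k''(b)|<\Delta_1\}$. The argmax denotes a point of $\mathcal{H}_{b,\ell}$ at which $|U_x(\cdot,b,\cdot)|$ attains its maximum over $\mathcal{H}_{b,\ell}$. *)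

(* Defs.v *)
(* MathComp-Analysis, with complex numbers R[i] from mathcomp-real-closed. *)
From HB Require Import structures.
From mathcomp Require Export all_boot all_order all_algebra.
From mathcomp Require Export all_classical all_reals all_analysis.
From mathcomp Require Export complex.

Set Implicit Arguments.
Unset Strict Implicit.
Unset Printing Implicit Defensive.

Import Order.TTheory GRing.Theory Num.Theory.
Import numFieldNormedType.Exports.

Local Open Scope classical_set_scope.
Local Open Scope complex_scope.
Local Open Scope ring_scope.

(* The modulus of a complex number, as an element of R (the norm `|z| of the
   library has its values in R[i]). *)
Notation cmod := ComplexField.Normc.normc.

Definition expi (R : realType) (theta : R) : R[i] := cos theta +i* sin theta.

(* Lebesgue integral over the whole line, componentwise. *)
Definition cintegral (R : realType) (f : R -> R[i]) : R[i] :=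
  (\int[@lebesgue_measure R]_t complex.Re (f t)) +i*
  (\int[@lebesgue_measure R]_t complex.Im (f t)).

Definition class_C3 (R : realType) (f : R -> R) : Prop :=
  (forall m : nat, (m < 3)%N ->
     forall t : R, derivable (f^`(m)%classic : R -> R) t 1) /\
  continuous (f^`(3)%classic : R -> R).

Definition component (R : realType) (A phi : R -> R) (t : R) : R[i] :=
  (A t)%:C * expi (2 * pi * phi t).

(* K = n.+1 >= 1 components, indexed by 'I_n.+1. *)
Definition signal (R : realType) (n : nat) (A phi : 'I_n.+1 -> R -> R) (t : R)
    : R[i] :=
  \sum_(k < n.+1) component (A k) (phi k) t.

(* The requirements on (A_k) and (phi_k) for [signal A phi] to be an element of
   the class E_(eps1, eps3). *)
Definition in_signal_class (R : realType) (eps1 eps3 : R) (n : nat)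
    (A phi : 'I_n.+1 -> R -> R) : Prop :=
  forall k : 'I_n.+1,
    [/\ A k \in Lfun (@lebesgue_measure R) +oo%E,
        forall t : R, 0 < A k t & class_C3 (phi k)] /\
    [/\ (0 < ereal_inf (range (fun b => ((phi k)^`()%classic b)%:E)))%E,
        (ereal_sup (range (fun b => ((phi k)^`()%classic b)%:E)) < +oo)%E,
        forall t tau : R, `|A k (t + tau) - A k t| <= eps1 * `|tau| * A k t
      & forall t : R, `|(phi k)^`(3)%classic t| <= eps3].

(* Windows may be complex-valued; real windows are those with Im g = 0. *)
Definition window (R : realType) (g : R -> R[i]) : Prop :=
  [/\ (fun t => complex.Re (g t)) \in Lfun (@lebesgue_measure R) 1%:E,
      (fun t => complex.Im (g t)) \in Lfun (@lebesgue_measure R) 1%:E,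
      (fun t => complex.Re (g t)) \in Lfun (@lebesgue_measure R) 2%:E
    & (fun t => complex.Im (g t)) \in Lfun (@lebesgue_measure R) 2%:E] /\
  [/\ (fun t => cmod (g t)) @ +oo --> (0 : R),
      (fun t => cmod (g t)) @ -oo --> (0 : R)
    & cintegral g = 1].

Definition tscr (R : realType) (g : R -> R[i]) (mu : R) (sigma : R -> R)
    (x : R -> R[i]) (a b lambda : R) : R[i] :=
  cintegral (fun t => x (b + a * t) * ((sigma b)^-1)%:C * g (t / sigma b) *
    expi (- (2 * pi * mu * t) - pi * lambda * a ^+ 2 * t ^+ 2)).

Definition pft (R : realType) (g : R -> R[i]) (eta lambda : R) : R[i] :=
  cintegral (fun t => g t * expi (- (2 * pi * eta * t) - pi * lambda * t ^+ 2)).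

(* Only the values of h on [0, +oo[ are relevant. *)
Definition decreasing_profile (R : realType) (h : R -> R) : Prop :=
  [/\ forall s t : R, 0 <= s -> s < t -> h t < h s,
      forall s : R, 0 <= s -> 0 <= h s,
      {within `[0, +oo[, continuous h}
    & h 0 = 1].

Definition admissible (R : realType) (g : R -> R[i]) (c0 : R)
    (beta gamma : R -> R) : Prop :=
  [/\ window g, 0 < c0 < 1, decreasing_profile beta,
      decreasing_profile gamma
    & exists f : R -> R -> R,
        (forall eta lambda : R, cmod (pft g eta lambda) = f `|eta| `|lambda|) /\
        (forall c eta lambda : R, 0 <= c <= c0 -> 0 <= eta -> 0 <= lambda ->
           1 - c <= f eta lambda -> 1 - c <= beta eta /\ 1 - c <= gamma lambda)].

(* The inverse of h : [0, +oo[ -> R.  A decreasing profile need not take all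
   the values in ]0, 1]; where the inverse is undefined (y is not a value of h)
   it is set to +oo, so that an upper bound by it carries no information. *)
Definition profile_inv (R : realType) (h : R -> R) (y : R) : \bar R :=
  if y \in h @` `[0, +oo[ then ('pinv_(fun=> 0) `[0, +oo[ h y)%:E else +oo%E.

(* I_n, possibly +oo: no moment of g is assumed to be finite a priori, hence
   the extended real values of the error terms below. *)
Definition abs_moment (R : realType) (g : R -> R[i]) (m : nat) : \bar R :=
  (\int[@lebesgue_measure R]_t (cmod (g t * (t ^+ m)%:C))%:E)%E.

(* Pi_0(b) is obtained for a = a2(b) and Pi_l(b) for
   a = (mu + Delta) / phi_l'(b), with s = sigma(b) in both cases. *)
Definition Pi_at (R : realType) (eps1 eps3 : R) (g : R -> R[i]) (s a : R)
    : \bar R :=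
  ((eps1 * s * a)%:E * abs_moment g 1 +
   (pi / 3 * eps3 * s ^+ 3 * a ^+ 3)%:E * abs_moment g 3)%E.

Definition Pi0 (R : realType) (eps1 eps3 : R) (g : R -> R[i])
    (sigma a2 : R -> R) (b : R) : \bar R :=
  Pi_at eps1 eps3 g (sigma b) (a2 b).

Definition Pil (R : realType) (eps1 eps3 : R) (g : R -> R[i])
    (sigma : R -> R) (mu Delta : R) (phil : R -> R) (b : R) : \bar R :=
  Pi_at eps1 eps3 g (sigma b) ((mu + Delta) / phil^`()%classic b).

Definition amp_min (R : realType) (n : nat) (A : 'I_n.+1 -> R -> R) (b : R) : R :=
  \big[Num.min/A ord0 b]_(k < n.+1) A k b.

Definition amp_sum (R : realType) (n : nat) (A : 'I_n.+1 -> R -> R) (b : R) : R :=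
  \sum_(k < n.+1) A k b.

(* All scales at b are confined to [a1(b), a2(b)]; [zone], [Upsilon_spec] and
   [Hset] have this restriction built in. *)
Definition scales (R : realType) (a1 a2 : R -> R) (b : R) : set R :=
  [set a | a1 b <= a <= a2 b].

Definition zone (R : realType) (mu Delta Delta1 : R) (a1 a2 : R -> R)
    (phik : R -> R) : set (R * R * R) :=
  [set p | let: (a, b, lambda) := p in
     [/\ scales a1 a2 b a, `|mu - a * phik^`()%classic b| < Delta
       & `|lambda - phik^`(2)%classic b| < Delta1]].

Definition comp_gain (R : realType) (g : R -> R[i]) (mu : R) (sigma : R -> R)
    (phik : R -> R) (a b lambda : R) : R :=
  cmod (pft g (sigma b * (mu - a * phik^`()%classic b))
              (sigma b ^+ 2 * a ^+ 2 * (lambda - phik^`(2)%classic b))).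

Definition Upsilon_spec (R : realType) (g : R -> R[i])
    (mu Delta Delta1 : R) (sigma a1 a2 : R -> R) (n : nat)
    (phi : 'I_n.+1 -> R -> R)
    (Ups : R -> R) (Upslk : 'I_n.+1 -> 'I_n.+1 -> R -> R) : Prop :=
  forall b : R,
  [/\ forall l k : 'I_n.+1, k != l -> Upslk l k b <= Ups b,
      forall k : 'I_n.+1,
        (ereal_sup [set (comp_gain g mu sigma (phi k) p.1 b p.2)%:E
           | p in [set p : R * R | scales a1 a2 b p.1 /\
               ~ (\bigcup_j zone mu Delta Delta1 a1 a2 (phi j)) (p.1, b, p.2)]]
         <= (Ups b)%:E)%E
    & forall l k : 'I_n.+1, k != l ->
        (ereal_sup [set (comp_gain g mu sigma (phi k) p.1 b p.2)%:E
           | p in [set p : R * R |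
               zone mu Delta Delta1 a1 a2 (phi l) (p.1, b, p.2)]]
         <= (Upslk l k b)%:E)%E].

Definition Err (R : realType) (eps1 eps3 : R) (g : R -> R[i])
    (mu Delta : R) (sigma : R -> R) (n : nat) (A phi : 'I_n.+1 -> R -> R)
    (Upslk : 'I_n.+1 -> 'I_n.+1 -> R -> R) (l : 'I_n.+1) (b : R) : \bar R :=
  ((amp_sum A b)%:E * Pil eps1 eps3 g sigma mu Delta (phi l) b +
   (\sum_(k < n.+1 | k != l) A k b * Upslk l k b)%:E)%E.

(* U a b lambda is the value of the transform at (a, b, lambda). *)
Definition Hset (R : realType) (U : R -> R -> R -> R[i]) (a1 a2 : R -> R)
    (epst : R -> R) (b : R) : set (R * R) :=
  [set p | scales a1 a2 b p.1 /\ epst b < cmod (U p.1 b p.2)].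

Definition Hsetk (R : realType) (U : R -> R -> R -> R[i]) (a1 a2 : R -> R)
    (epst : R -> R) (mu Delta Delta1 : R) (phik : R -> R) (b : R)
    : set (R * R) :=
  [set p | [/\ Hset U a1 a2 epst b p, `|mu - p.1 * phik^`()%classic b| < Delta
             & `|p.2 - phik^`(2)%classic b| < Delta1]].

Definition is_argmax (R : realType) (T : Type) (D : set T) (F : T -> R) (p : T)
    : Prop :=
  D p /\ forall q, D q -> F q <= F p.

(* In the three bounds E stands for Err_l(b) and Al for A_l(b); [fine E] is E
   itself because E is finite in all uses. *)
Definition Bd1 (R : realType) (beta : R -> R) (sigmab : R) (E : \bar R) (Al : R)
    : \bar R :=
  ((sigmab^-1)%:E * profile_inv beta (1 - 2 * fine E / Al)%R)%E.

Definition Bd2 (R : realType) (gamma : R -> R) (sigmab a : R) (E : \bar R)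
    (Al : R) : \bar R :=
  (((sigmab ^+ 2 * a ^+ 2)^-1)%:E * profile_inv gamma (1 - 2 * fine E / Al)%R)%E.

Definition Bd3 (R : realType) (g : R -> R[i]) (beta gamma : R -> R)
    (E : \bar R) (Al : R) : \bar R :=
  (E + (2 * pi * Al)%:E * abs_moment g 1 *
         profile_inv beta (1 - 2 * fine E / Al)%R
     + (pi * Al)%:E * abs_moment g 2 *
         profile_inv gamma (1 - 2 * fine E / Al)%R)%E.

(* Main.v *)
Require Import Defs.
From mathcomp Require Import ring lra measurable_realfun.

Set Implicit Arguments.
Unset Strict Implicit.
Unset Printing Implicit Defensive.

Import Order.TTheory GRing.Theory Num.Theory.
Import numFieldNormedType.Exports.

Local Open Scope classical_set_scope.
Local Open Scope complex_scope.
Local Open Scope ring_scope.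

(** The transform is, up to a small error, a superposition of translated copies
of one profile, the polynomial Fourier transform of the window; each ridge of
the transform then sits where that profile is close to its value 1 at 0.

Around a fixed time b, every component is replaced by its local model: the
amplitude is frozen at A_k(b) and the phase is cut after its quadratic Taylor
term ([taylor2_remainder], [component_remainder]).  The transform of the local
model at (a, b, lambda) is exactly x_k(b) times the polynomial Fourier transform
of g at (sigma (mu - a phi_k'), sigma^2 a^2 (lambda - phi_k'')), called the gain
of component k below.  Integrating the pointwise remainder against |g| gives
[tscr_approx]: the total error is at most M(b) Pi(a), with Pi(a) increasing in
the scale a.  Inside the zone of component l the other gains are bounded by
Upsilon_{l,k}, so only component l remains, up to Err_l ([zone_approx_Err]).

At the ridge point a = mu / phi_l', lambda = phi_l'' the gain of component l is
exactly 1, hence |U| >= A_l - Err_l there.  The threshold is small enough for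
this point to belong to H_{b,l} ([ridge_above_threshold]), so the maximum over
H_{b,l} is at least A_l - Err_l as well ([peak_ge]).  On the other hand it is at
most A_l |gain| + Err_l.  Comparing the two gives |gain| >= 1 - 2 Err_l / A_l at
the maximum ([peak_gain_ge]), and admissibility of the window turns this into
the bounds of (a) on the two arguments of the gain.  For (b), the gain differs
from 1 by an integral of g (e^{i theta} - 1), at most a combination of first and
second moments of g times these two arguments ([pft_near1]).  For (c), a
nonnegative window of integral 1 has gain at most 1 in modulus ([pft_le1]).

Two points need care.  The moments of g are extended real numbers; the bound
2 Err_l / A_l <= c0 makes the moments of order 1 and 3, hence also 2, finite
([Err_lty_moments]), after which all the errors are real numbers.  And
membership in H_{b,l} is a strict inequality: it comes from Pi(mu / phi_l') <
Pi(a2), which needs a nonzero first moment ([admissible_moment1_gt0]). *)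

(** * The complex modulus, oscillating exponentials and Taylor remainders *)

Section Elementary.
Context {R : realType}.
Implicit Types (x y : R) (z w : R[i]).

Lemma cmod_ge0 z : 0 <= cmod z.
Proof. by case: z => u v; exact: sqrtr_ge0. Qed.

Lemma sqr_cmod z : cmod z ^+ 2 = complex.Re z ^+ 2 + complex.Im z ^+ 2.
Proof. by case: z => u v /=; rewrite sqr_sqrtr// addr_ge0// sqr_ge0. Qed.

Lemma cmodD_le z w : cmod (z + w) <= cmod z + cmod w.
Proof. exact: le_normcD. Qed.

Lemma cmodN z : cmod (- z) = cmod z.
Proof. exact: normcN. Qed.

Lemma cmodB_ge z w : cmod z - cmod w <= cmod (z - w).
Proof. by rewrite lerBlDr -{1}(subrK w z) cmodD_le. Qed.

Lemma cmod_sum_le (I : finType) (P : pred I) (F : I -> R[i]) :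
  cmod (\sum_(i | P i) F i) <= \sum_(i | P i) cmod (F i).
Proof.
elim/big_ind2 : _ => [|z u w v zu wv|//]; first by rewrite ComplexField.Normc.normc0.
by rewrite (le_trans (cmodD_le _ _))// lerD.
Qed.

Lemma cmod_real x : cmod x%:C = `|x|.
Proof. by rewrite /= expr0n/= addr0 sqrtr_sqr. Qed.

Lemma Re_le_cmod z : `|complex.Re z| <= cmod z.
Proof.
rewrite -sqrtr_sqr; case: z => u v /=.
by rewrite ler_wsqrtr// lerDl sqr_ge0.
Qed.

Lemma Im_le_cmod z : `|complex.Im z| <= cmod z.
Proof.
rewrite -sqrtr_sqr; case: z => u v /=.
by rewrite ler_wsqrtr// lerDr sqr_ge0.
Qed.

Lemma cmod_le_ReIm z : cmod z <= `|complex.Re z| + `|complex.Im z|.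
Proof.
rewrite -(ler_pXn2r (n := 2))// ?nnegrE ?cmod_ge0 ?addr_ge0//.
rewrite sqr_cmod sqrrD !real_normK ?num_real// -addrA lerD2l lerDr.
by rewrite mulrn_wge0// mulr_ge0.
Qed.

Lemma is_derive_fctB (F G : R -> R) (x dF dG : R) :
  is_derive x 1 F dF -> is_derive x 1 G dG ->
  is_derive x 1 (fun t => F t - G t) (dF - dG).
Proof. exact: is_deriveB. Qed.

Lemma is_derive_fctN (F : R -> R) (x dF : R) :
  is_derive x 1 F dF -> is_derive x 1 (fun t => - F t) (- dF).
Proof. exact: is_deriveN. Qed.

Lemma is_derive_fctD (F G : R -> R) (x dF dG : R) :
  is_derive x 1 F dF -> is_derive x 1 G dG ->
  is_derive x 1 (fun t => F t + G t) (dF + dG).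
Proof. exact: is_deriveD. Qed.

Lemma is_derive_monomial (c x : R) (m : nat) :
  is_derive x 1 (fun t : R => c * t ^+ m) (c * (m%:R * x ^+ m.-1)).
Proof.
have H : is_derive x 1 (c \*: (@id R ^+ m)) (c *: ((m%:R * x ^+ m.-1) *: 1)).
  exact: is_deriveZ.
have -> : (fun t : R => c * t ^+ m) = c \*: (@id R ^+ m).
  by apply/funext => t; rewrite /= exprfctE.
by apply: (is_derive_eq H); rewrite /GRing.scale/= mulr1.
Qed.

(** Integrates a power bound on a derivative; three applications to a function
    with bounded third derivative give the second-order Taylor remainder, and one
    application to the sine gives |sin x| <= |x|. *)
Lemma primitive_power_bound (F dF : R -> R) (C : R) (m : nat) :
  (forall s : R, is_derive s 1 F (dF s)) -> F 0 = 0 ->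
  (forall s, `|dF s| <= C * `|s| ^+ m) ->
  forall s, `|F s| <= C / m.+1%:R * `|s| ^+ m.+1.
Proof.
move=> hF F0 hdF s.
have C0 : m.+1%:R != 0 :> R by rewrite pnatr_eq0.
(* Negative s are reduced to positive ones by reflecting F. *)
wlog s0 : F dF s hF F0 hdF / 0 <= s.
  move=> H; have [s0|/ltW s0] := leP 0 s; first exact: (H F dF).
  have := H (F \o -%R) (fun t => - dF (- t)) (- s) _ _ _ _.
  rewrite /= opprK normrN; apply.
  - by move=> t; apply: is_derive_eq; rewrite /GRing.scale/= mulrN1.
  - by rewrite oppr0.
  - by move=> t; rewrite normrN -(normrN t).
  - by rewrite oppr_ge0.
have hP (e : R) : is_derive e 1 (fun t : R => C / m.+1%:R * t ^+ m.+1) (C * e ^+ m).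
  apply: (is_derive_eq (is_derive_monomial _ _ _)).
  by rewrite /= mulrA divfK.
have ndecr (G dG : R -> R) : (forall t : R, is_derive t 1 G (dG t)) -> G 0 = 0 ->
    (forall t, 0 <= t -> 0 <= dG t) -> 0 <= G s.
  move=> hG G0 dG0.
  have [|c cs] := @MVT_segment R G dG 0 s s0 (fun t _ => hG t).
    apply: derivable_within_continuous => t _.
    by have [] := hG t.
  rewrite G0 !subr0 => ->; apply: mulr_ge0 => //; apply: dG0.
  by rewrite (itvP cs).
(* C t^(m+1) / (m+1) + F and C t^(m+1) / (m+1) - F are both nondecreasing. *)
rewrite (ger0_norm s0) ler_norml; apply/andP; split.
- rewrite lerNl -subr_ge0.
  apply: (ndecr (fun t => C / m.+1%:R * t ^+ m.+1 - - F t)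
            (fun t => C * t ^+ m - - dF t)).
  + by rewrite F0 expr0n/= mulr0 oppr0 subrr.
  + move=> t t0; rewrite subr_ge0 lerNl.
    by have := hdF t; rewrite ler_norml ger0_norm// => /andP[].
- rewrite -subr_ge0.
  apply: (ndecr (fun t => C / m.+1%:R * t ^+ m.+1 - F t)
            (fun t => C * t ^+ m - dF t)).
  + by rewrite F0 expr0n/= mulr0 subrr.
  + move=> t t0; rewrite subr_ge0.
    by have := hdF t; rewrite ler_norml ger0_norm// => /andP[].
Qed.

Lemma abs_sin_le x : `|sin x| <= `|x|.
Proof.
have := @primitive_power_bound sin cos 1 0 (fun s => is_derive_sin s) (sin0 R).
move=> /(_ _ x); rewrite !expr1 divr1 mul1r; apply => s.
by rewrite mulr1 cos_max.
Qed.

Lemma cmod_expi x : cmod (expi x) = 1.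
Proof. by rewrite /= cos2Dsin2 sqrtr1. Qed.

Lemma expiD x y : expi (x + y) = expi x * expi y.
Proof.
rewrite /expi cosD sinD; apply/eqP; rewrite eq_complex /=.
by rewrite eqxx /= addrC.
Qed.

Lemma expi0 : expi (0 : R) = 1.
Proof. by rewrite /expi cos0 sin0. Qed.

(** A chord is shorter than its arc: the half-angle formulas give
    |e^{ix} - 1| = 2 |sin (x / 2)|. *)
Lemma cmod_expiB1_le x : cmod (expi x - 1) <= `|x|.
Proof.
have -> : x = (x / 2) *+ 2 by rewrite -mulr_natr divfK// pnatr_eq0.
set y := x / 2.
rewrite -(ler_pXn2r (n := 2))// ?nnegrE ?cmod_ge0//.
rewrite sqr_cmod/= cos_mulr2n sin_mulr2n real_normK ?num_real//.
have : sin y ^+ 2 <= y ^+ 2.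
  rewrite -[leLHS](real_normK (num_real _)) -[leRHS](real_normK (num_real _)).
  by rewrite ler_pXn2r// ?nnegrE// abs_sin_le.
have := cos2Dsin2 y; move: (cos y) (sin y) => c s cs hs.
have -> : (c ^+ 2 *+ 2 - 1 - 1) ^+ 2 + ((c * s) *+ 2 - 0) ^+ 2 = 4 * s ^+ 2.
  have c2 : c ^+ 2 = 1 - s ^+ 2 by rewrite -cs addrK.
  transitivity (4 * (c ^+ 2 - 1) ^+ 2 + 4 * c ^+ 2 * s ^+ 2); first by ring.
  by rewrite c2; ring.
have -> : (y *+ 2) ^+ 2 = 4 * y ^+ 2 by ring.
by rewrite ler_pM2l.
Qed.

Lemma taylor2_remainder (f : R -> R) (C : R) : class_C3 f ->
  (forall t, `|f^`(3)%classic t| <= C) ->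
  forall b s, `|f (b + s) -
     (f b + f^`()%classic b * s + f^`(2)%classic b * s ^+ 2 / 2)|
    <= C / 6 * `|s| ^+ 3.
Proof.
move=> [df _] hC b s.
have hd m : (m < 3)%N -> forall t : R,
    is_derive t 1 (fun u => f^`(m)%classic (b + u)) (f^`(m.+1)%classic (b + t)).
  move=> m3 t.
  have := df m m3 (b + t) => /derivableP d0.
  have d1 : is_derive (b + t) 1 (f^`(m)%classic) (f^`(m.+1)%classic (b + t)).
    by rewrite /derive1n iterS -/(derive1n _ _) derive1E.
  by apply: is_derive_eq; rewrite /GRing.scale/= add0r mulr1.
have h2 t : `|f^`(2)%classic (b + t) - f^`(2)%classic b| <= C * `|t|.
  have := @primitive_power_bound
    (fun u => f^`(2)%classic (b + u) - f^`(2)%classic b)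
    (fun u => f^`(3)%classic (b + u)) C 0 _ _ _ t.
  rewrite divr1 expr1; apply.
  - move=> u; have := hd 2%N isT u => /= d2.
    exact: is_derive_eq (is_derive_fctB d2 (is_derive_cst _ _ _)) (subr0 _).
  - by rewrite addr0 subrr.
  - by move=> u; rewrite mulr1.
have h1 t : `|f^`()%classic (b + t) -
    (f^`()%classic b + f^`(2)%classic b * t)| <= C / 2 * `|t| ^+ 2.
  apply: (@primitive_power_bound
    (fun u => f^`()%classic (b + u) - (f^`()%classic b + f^`(2)%classic b * u))
    (fun u => f^`(2)%classic (b + u) - f^`(2)%classic b) C 1) => //.
  - move=> u; have := hd 1%N isT u => /= d1.
    apply: (is_derive_fctB d1).
    have := is_derive_fctD (is_derive_cst (f^`()%classic b) u 1)
      (is_derive_monomial (f^`(2)%classic b) u 1).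
    by rewrite /= expr0 !mulr1 add0r.
  - by rewrite addr0 mulr0 addr0 subrr.
have -> : C / 6 = C / 2 / 3 by field.
apply: (@primitive_power_bound
    (fun u => f (b + u) -
       (f b + f^`()%classic b * u + f^`(2)%classic b * u ^+ 2 / 2))
    (fun u => f^`()%classic (b + u) - (f^`()%classic b + f^`(2)%classic b * u))
    (C / 2) 2) => //.
- move=> u; have := hd 0%N isT u => /= d1.
  apply: (is_derive_fctB d1).
  have := is_derive_fctD (is_derive_fctD (is_derive_cst (f b) u 1)
    (is_derive_monomial (f^`()%classic b) u 1))
    (is_derive_monomial (f^`(2)%classic b / 2) u 2).
  rewrite /= expr0 expr1 !mulr1 add0r mulrA divfK// => H.
  under [X in is_derive _ _ X _]funext do rewrite -[_ / 2]mulrAC.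
  exact: H.
- by rewrite addr0 mulr0 expr0n/= mulr0 mul0r !addr0 subrr.
Qed.

(** The pointwise error of the local model of a component.  The amplitude
    contributes e1 |s|; the phase contributes 2 pi times its Taylor remainder
    e3 |s|^3 / 6, which is the origin of the constant pi / 3. *)
Lemma component_remainder (A phi : R -> R) (e1 e3 b s : R) :
  class_C3 phi -> (forall t, `|phi^`(3)%classic t| <= e3) ->
  0 <= A b -> `|A (b + s) - A b| <= e1 * `|s| * A b ->
  cmod (component A phi (b + s) - component A phi b *
     expi (2 * pi * phi^`()%classic b * s + pi * phi^`(2)%classic b * s ^+ 2))
  <= A b * (e1 * `|s| + pi / 3 * e3 * `|s| ^+ 3).
Proof.
move=> hphi h3 A0 hA; set q := (X in expi X); rewrite /component.
have := taylor2_remainder hphi h3 b s.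
set r := phi (b + s) - _ => hr.
have -> : expi (2 * pi * phi (b + s)) =
    expi (2 * pi * phi b) * expi q * expi (2 * pi * r).
  by rewrite -!expiD; congr expi; rewrite /r /q; field.
set e := expi _; set e' := expi q; set d := expi _.
have -> : (A (b + s))%:C * (e * e' * d) - (A b)%:C * e * e' =
   (A (b + s) - A b)%:C * (e * e' * d) + (A b)%:C * (e * e') * (d - 1).
  by rewrite rmorphB/=; ring.
rewrite (le_trans (cmodD_le _ _))// !ComplexField.Normc.normcM.
rewrite !cmod_expi !cmod_real !mulr1.
rewrite (ger0_norm A0) mulrDr lerD// mulrC//.
rewrite mulrC ler_wpM2l//; apply: (le_trans (cmod_expiB1_le _)).
rewrite normrM ger0_norm ?mulr_ge0 ?pi_ge0//.
have -> : pi / 3 * e3 * `|s| ^+ 3 = 2 * pi * (e3 / 6 * `|s| ^+ 3) by field.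
by rewrite ler_wpM2l// mulr_ge0// pi_ge0.
Qed.

End Elementary.

(** * Integration of complex-valued functions *)

Definition cmeasurable (R : realType) (f : R -> R[i]) : Prop :=
  measurable_fun setT (fun t => complex.Re (f t)) /\
  measurable_fun setT (fun t => complex.Im (f t)).

Definition rintegrable (R : realType) (h : R -> R) : Prop :=
  (@lebesgue_measure R).-integrable setT (EFin \o h).

Definition cintegrable (R : realType) (f : R -> R[i]) : Prop :=
  rintegrable (fun t => complex.Re (f t)) /\
  rintegrable (fun t => complex.Im (f t)).

Section ComplexIntegral.
Context {R : realType}.
Notation mu := (@lebesgue_measure R).
Implicit Types (f g : R -> R[i]) (h : R -> R).

Lemma ReM (z w : R[i]) : complex.Re (z * w) =
  complex.Re z * complex.Re w - complex.Im z * complex.Im w.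
Proof. by case: z w => ? ? []. Qed.

Lemma ImM (z w : R[i]) : complex.Im (z * w) =
  complex.Re z * complex.Im w + complex.Im z * complex.Re w.
Proof. by case: z w => ? ? []. Qed.

Lemma ReD (z w : R[i]) : complex.Re (z + w) = complex.Re z + complex.Re w.
Proof. by case: z w => ? ? []. Qed.

Lemma ImD (z w : R[i]) : complex.Im (z + w) = complex.Im z + complex.Im w.
Proof. by case: z w => ? ? []. Qed.

Lemma cmeasurableM f g :
  cmeasurable f -> cmeasurable g -> cmeasurable (fun t => f t * g t).
Proof.
move=> [fr fi] [gr gi]; split.
- under eq_fun do rewrite ReM.
  by apply: measurable_funB; apply: measurable_funM.
- under eq_fun do rewrite ImM.
  by apply: measurable_funD; apply: measurable_funM.
Qed.

Lemma cmeasurableD f g :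
  cmeasurable f -> cmeasurable g -> cmeasurable (fun t => f t + g t).
Proof.
move=> [fr fi] [gr gi]; split.
- by under eq_fun do rewrite ReD; exact: measurable_funD.
- by under eq_fun do rewrite ImD; exact: measurable_funD.
Qed.

Lemma cmeasurable_sum (I : finType) (F : I -> R -> R[i]) :
  (forall k, cmeasurable (F k)) -> cmeasurable (fun t => \sum_k F k t).
Proof.
move=> mF; split.
- have -> : (fun t => complex.Re (\sum_k F k t)) =
            (fun t => \sum_k complex.Re (F k t)).
    by apply/funext => t; elim/big_rec2 : _ => // k x y _ <-; exact: ReD.
  by apply: measurable_sum => k; case: (mF k).
- have -> : (fun t => complex.Im (\sum_k F k t)) =
            (fun t => \sum_k complex.Im (F k t)).
    by apply/funext => t; elim/big_rec2 : _ => // k x y _ <-; exact: ImD.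
  by apply: measurable_sum => k; case: (mF k).
Qed.

Lemma cmeasurable_real h :
  measurable_fun setT h -> cmeasurable (fun t => (h t)%:C).
Proof. by move=> mh; split => //=. Qed.

Lemma cmeasurable_expi h :
  measurable_fun setT h -> cmeasurable (fun t => expi (h t)).
Proof.
move=> mh; split => /=.
- apply: (measurableT_comp (f := @cos R)) => //.
  by apply: continuous_measurable_fun; exact: continuous_cos.
- apply: (measurableT_comp (f := @sin R)) => //.
  by apply: continuous_measurable_fun; exact: continuous_sin.
Qed.

Lemma cmeasurable_cst (z : R[i]) : cmeasurable (fun=> z).
Proof. by split. Qed.

Lemma measurable_cmod f : cmeasurable f -> measurable_fun setT (fun t => cmod (f t)).
Proof.
move=> [fr fi].
have -> : (fun t => cmod (f t)) =
    (fun t => Num.sqrt (complex.Re (f t) ^+ 2 + complex.Im (f t) ^+ 2)).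
  by apply/funext => t; case: (f t).
apply: (measurableT_comp (f := @Num.sqrt R)).
  by apply: continuous_measurable_fun; exact: sqrt_continuous.
by apply: measurable_funD; apply: measurable_funX.
Qed.

Lemma rintegrable_le h h' : measurable_fun setT h -> rintegrable h' ->
  (forall t, `|h t| <= h' t) -> rintegrable h.
Proof.
move=> mh ih' hh'; apply: le_integrable ih' => //.
  exact/measurable_EFinP.
by move=> t _; rewrite lee_fin (le_trans (hh' t))// ler_norm.
Qed.

Lemma rintegrableD h h' :
  rintegrable h -> rintegrable h' -> rintegrable (fun t => h t + h' t).
Proof. exact: integrableD. Qed.

Lemma rintegrableZ (k : R) h : rintegrable h -> rintegrable (fun t => k * h t).
Proof. exact: integrableZl. Qed.

Lemma cintegrable_le f h : cmeasurable f -> rintegrable h ->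
  (forall t, cmod (f t) <= h t) -> cintegrable f.
Proof.
move=> [fr fi] ih fh; split; apply: rintegrable_le ih _ => // t.
- by rewrite (le_trans (Re_le_cmod _)).
- by rewrite (le_trans (Im_le_cmod _)).
Qed.

Lemma cintegrableD f g :
  cintegrable f -> cintegrable g -> cintegrable (fun t => f t + g t).
Proof.
move=> [fr fi] [gr gi]; split.
- under eq_fun do rewrite ReD.
  exact: rintegrableD.
- under eq_fun do rewrite ImD.
  exact: rintegrableD.
Qed.

Lemma cintegralD f g : cintegrable f -> cintegrable g ->
  cintegral (fun t => f t + g t) = cintegral f + cintegral g.
Proof.
move=> [fr fi] [gr gi]; rewrite /cintegral.
under eq_Rintegral do rewrite ReD.
rewrite RintegralD//.
under [X in _ +i* X]eq_Rintegral do rewrite ImD.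
by rewrite RintegralD.
Qed.

Lemma cintegrableZ (z : R[i]) f : cintegrable f -> cintegrable (fun t => z * f t).
Proof.
move=> [fr fi]; split.
- under eq_fun do rewrite ReM -mulNr.
  by apply: rintegrableD; exact: rintegrableZ.
- under eq_fun do rewrite ImM.
  by apply: rintegrableD; exact: rintegrableZ.
Qed.

Lemma cintegralZ (z : R[i]) f : cintegrable f ->
  cintegral (fun t => z * f t) = z * cintegral f.
Proof.
move=> [fr fi]; rewrite /cintegral.
under eq_Rintegral do rewrite ReM -mulNr.
rewrite RintegralD//; [|exact: rintegrableZ..].
under [X in _ +i* X]eq_Rintegral do rewrite ImM.
rewrite RintegralD//; [|exact: rintegrableZ..].
rewrite !RintegralZl//.
by apply/eqP; rewrite eq_complex ReM ImM /= mulNr !eqxx.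
Qed.

Lemma cintegrable_sum (I : finType) (c : I -> R[i]) (F : I -> R -> R[i]) :
  (forall k, cintegrable (F k)) -> cintegrable (fun t => \sum_k c k * F k t).
Proof.
move=> iF; rewrite /index_enum; elim: (Finite.enum I) => [|k s ih].
  under eq_fun do rewrite big_nil.
  by split; exact: integrable0.
under eq_fun do rewrite big_cons.
by apply: cintegrableD => //; exact: cintegrableZ.
Qed.

Lemma cintegral_sum (I : finType) (c : I -> R[i]) (F : I -> R -> R[i]) :
  (forall k, cintegrable (F k)) ->
  cintegral (fun t => \sum_k c k * F k t) = \sum_k c k * cintegral (F k).
Proof.
move=> iF.
suff : cintegrable (fun t => \sum_k c k * F k t) /\
  cintegral (fun t => \sum_k c k * F k t) = \sum_k c k * cintegral (F k).
  by case.
rewrite /index_enum; elim: (Finite.enum I) => [|k s [ih1 ih2]].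
  under eq_fun do rewrite big_nil.
  rewrite big_nil; split; first by split; exact: integrable0.
  by rewrite /cintegral /= /Rintegral integral0.
under eq_fun do rewrite big_cons.
split; first by apply: cintegrableD => //; exact: cintegrableZ.
by rewrite big_cons cintegralD ?cintegralZ ?ih2//; exact: cintegrableZ.
Qed.

(** As the integral is taken componentwise, the triangle inequality is reduced
    to the real case by projecting on the direction of z, the integral of f:
    |z|^2 is the integral of the scalar product of z and f, at most |z| |f|. *)
Lemma cmod_cintegral_le f h : cintegrable f -> rintegrable h ->
  (forall t, cmod (f t) <= h t) -> cmod (cintegral f) <= \int[mu]_t h t.
Proof.
move=> [fr fi] ih fh.
have h0 t : 0 <= h t by rewrite (le_trans (cmod_ge0 _) (fh t)).
set z := cintegral f.
have := cmod_ge0 z; rewrite le_eqVlt => /predU1P[<-|z0].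
  exact: Rintegral_ge0.
rewrite -(ler_pM2l z0) -expr2 sqr_cmod !expr2.
have -> : complex.Re z * complex.Re z + complex.Im z * complex.Im z =
    \int[mu]_t (complex.Re z * complex.Re (f t) + complex.Im z * complex.Im (f t)).
  by rewrite RintegralD//; [rewrite !RintegralZl|exact: rintegrableZ..].
rewrite -RintegralZl//.
apply: le_Rintegral => //; [|exact: rintegrableZ|].
  by apply: rintegrableD; exact: rintegrableZ.
move=> t _; apply: (@le_trans _ _ (cmod z * cmod (f t))); last first.
  by rewrite ler_wpM2l// ltW.
(* What remains is the Cauchy-Schwarz inequality in the plane. *)
have := sqr_cmod z; have := sqr_cmod (f t).
have := cmod_ge0 (f t); move: z0.
move: (cmod z) (cmod (f t)) (complex.Re z) (complex.Im z) => p q a b.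
move: (complex.Re (f t)) (complex.Im (f t)) => c d p0 q0 eq ep.
have [ac0|ac0] := leP (a * c + b * d) 0.
  by rewrite (le_trans ac0)// mulr_ge0// ltW.
rewrite -(ler_pXn2r (n := 2))// ?nnegrE ?mulr_ge0// ?(ltW p0) ?(ltW ac0)//.
rewrite exprMn ep eq -subr_ge0.
have -> : (a ^+ 2 + b ^+ 2) * (c ^+ 2 + d ^+ 2) - (a * c + b * d) ^+ 2 =
  (a * d - b * c) ^+ 2 by ring.
exact: sqr_ge0.
Qed.

End ComplexIntegral.

(** * Dilations of the line *)

Section Dilation.
Context {R : realType}.
Notation mu := (@lebesgue_measure R).
Variable s : R.
Hypothesis s0 : 0 < s.

Lemma measurable_dilation : measurable_fun setT (fun t : R => t / s).
Proof. exact: measurable_funM. Qed.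

(** The image measure divided by s gives every interval its length, and Lebesgue
    measure is the only measure doing so. *)
Lemma lebesgue_measure_dilation (A : set R) : measurable A ->
  pushforward mu (fun t : R => t / s) A = (s%:E * mu A)%E.
Proof.
move=> mA.
pose si : {nonneg R} := NngNum (ltW (divr_gt0 ltr01 s0)).
have mphi : measurable_fun setT
  ((fun t : R => t / s) : measurableTypeR R -> measurableTypeR R).
  exact: measurable_dilation.
(* The measure structure of an image measure depends on a proof that the map is
   measurable: pf is a function of that proof. *)
pose pf :=
  [the {measure set (measurableTypeR R) -> \bar R} of
   pushforward mu ((fun t : R => t / s) : measurableTypeR R -> measurableTypeR R)].
have h : forall A, measurable A -> mu A = mscale si (pf mphi) A.
  have := @lebesgue_measure_unique R (mscale si (pf mphi)).
  apply => _ [[a b]] _ <-.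
  have pre : (fun t : R => t / s) @^-1` `]a, b] = `](a * s), (b * s)]%classic.
    apply/seteqP; split => t /=; rewrite !in_itv/=.
      by rewrite ltr_pdivlMr// ler_pdivrMr.
    by rewrite ltr_pdivlMr// ler_pdivrMr.
  transitivity ((1 / s)%:E * mu `](a * s)%R, (b * s)%R]%classic)%E.
    2: by rewrite -pre.
  rewrite !lebesgue_measure_itv/= !lte_fin ltr_pM2r//.
  case: ifP => _; last by rewrite mule0.
  by rewrite -!EFinB -EFinM -mulrBl; congr EFin; field; rewrite gt_eqF.
set P := pushforward _ _ _.
have -> : mu A = ((1 / s)%:E * P)%E by exact: h.
by rewrite muleA -EFinM mul1r divff ?gt_eqF// mul1e.
Qed.

Lemma ge0_integral_dilation (F : R -> \bar R) : measurable_fun setT F ->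
  (forall t, 0 <= F t)%E ->
  (\int[mu]_t F (t / s)%R = s%:E * \int[mu]_t F t)%E.
Proof.
move=> mF F0.
pose sp : {nonneg R} := NngNum (ltW s0).
have mphi : measurable_fun setT
  ((fun t : R => t / s) : measurableTypeR R -> measurableTypeR R).
  exact: measurable_dilation.
have := @ge0_integral_pushforward _ _ _ _ R _ mphi mu setT F.
rewrite preimage_setT => <- //.
rewrite -[s]/(sp%:num) -ge0_integral_mscale//.
by apply: eq_measure_integral => A mA _; exact: lebesgue_measure_dilation.
Qed.

Lemma Rintegral_dilation (h : R -> R) : rintegrable h ->
  \int[mu]_t h (t / s) = s * \int[mu]_t h t.
Proof.
move=> ih; rewrite /Rintegral.
have mh : measurable_fun setT (EFin \o h) := measurable_int _ ih.
rewrite -[s in RHS]/(fine s%:E) -fineM//; last exact: integrable_fin_num.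
congr fine; rewrite integralE [in RHS]integralE.
rewrite muleBr//; last first.
  by apply: fin_num_adde_defl; rewrite fin_numN; exact: integrable_neg_fin_num.
rewrite -!ge0_integral_dilation//; last 2 first.
  exact: measurable_funeneg.
  exact: measurable_funepos.
by congr (_ - _)%E; apply: eq_integral => t _; rewrite !(funeposE, funenegE).
Qed.

Lemma rintegrable_dilation (h : R -> R) :
  rintegrable h -> rintegrable (fun t => h (t / s)).
Proof.
move=> /integrableP[mh ih]; apply/integrableP; split.
  by apply: (measurableT_comp mh); exact: measurable_dilation.
rewrite (ge0_integral_dilation (F := fun t => `|(h t)%:E|%E))//.
  by rewrite lte_mul_pinfty// lee_fin ltW.
exact: measurableT_comp.
Qed.

(** The change of variables of the transform, where the window appears as
    g(t / sigma) / sigma. *)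
Lemma cintegral_dilation (f : R -> R[i]) : cintegrable f ->
  cintegral (fun t => (s^-1)%:C * f (t / s)) = cintegral f.
Proof.
move=> [fr fi]; rewrite cintegralZ; last first.
  by split; [exact: (rintegrable_dilation fr)|exact: (rintegrable_dilation fi)].
rewrite /cintegral (Rintegral_dilation fr) (Rintegral_dilation fi).
have s1 : s != 0 by rewrite gt_eqF.
apply/eqP; rewrite eq_complex /= !mul0r subr0 addr0 !mulKf//.
by apply/andP; split; apply/eqP.
Qed.

End Dilation.

(** * Moments and polynomial Fourier transform of a window *)

Section WindowMoments.
Context {R : realType}.
Notation mu := (@lebesgue_measure R).
Variable g : R -> R[i].

Definition moment_density (m : nat) (t : R) : R := cmod (g t) * `|t| ^+ m.

(** The real-valued counterpart of [abs_moment]; it carries information only when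
    the moment is finite. *)
Definition moment (m : nat) : R := \int[mu]_t moment_density m t.

Lemma moment_density_ge0 m t : 0 <= moment_density m t.
Proof. by rewrite mulr_ge0 ?cmod_ge0 ?exprn_ge0. Qed.

Lemma cmod_mul_power (t : R) (m : nat) :
  cmod (g t * (t ^+ m)%:C) = moment_density m t.
Proof. by rewrite ComplexField.Normc.normcM cmod_real normrX. Qed.

Hypothesis mg : cmeasurable g.

Lemma measurable_moment_density m : measurable_fun setT (moment_density m).
Proof.
apply: measurable_funM; first exact: measurable_cmod.
by apply: measurable_funX; exact: normr_measurable.
Qed.

Lemma rintegrable_moment_density m :
  (abs_moment g m < +oo)%E -> rintegrable (moment_density m).
Proof.
move=> gm; apply/integrableP; split.
  by apply/measurable_EFinP; exact: measurable_moment_density.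
apply: le_lt_trans gm; rewrite /abs_moment.
rewrite le_eqVlt; apply/orP; left; apply/eqP; apply: eq_integral => t _.
by rewrite cmod_mul_power /= ger0_norm// moment_density_ge0.
Qed.

Lemma abs_momentE m :
  rintegrable (moment_density m) -> abs_moment g m = (moment m)%:E.
Proof.
move=> gm; rewrite /abs_moment /moment /Rintegral fineK; last first.
  exact: integrable_fin_num.
by apply: eq_integral => t _; rewrite cmod_mul_power.
Qed.

Lemma moment_ge0 m : 0 <= moment m.
Proof. by apply: Rintegral_ge0 => t _; exact: moment_density_ge0. Qed.

(** The second moment is dominated by the sum of the two others, since
    t^2 <= |t| + |t|^3. *)
Lemma rintegrable_moment2 : rintegrable (moment_density 1) ->
  rintegrable (moment_density 3) -> rintegrable (moment_density 2).
Proof.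
move=> g1 g3; apply: rintegrable_le (rintegrableD g1 g3) _.
  exact: measurable_moment_density.
move=> t; rewrite ger0_norm ?moment_density_ge0// /moment_density -mulrDr.
rewrite ler_wpM2l ?cmod_ge0// expr1 expr2 !exprS expr0 mulr1.
by have := normr_ge0 t; move: `|t| => u u0; nra.
Qed.

End WindowMoments.

Section WindowTransform.
Context {R : realType}.
Notation mu := (@lebesgue_measure R).
Variable g : R -> R[i].
Hypothesis ig : cintegrable g.

Lemma cintegrable_cmeasurable : cmeasurable g.
Proof.
case: ig => gr gi; split.
- by have /measurable_EFinP := measurable_int _ gr.
- by have /measurable_EFinP := measurable_int _ gi.
Qed.
Let mg := cintegrable_cmeasurable.

Lemma rintegrable_cmod : rintegrable (fun t => cmod (g t)).
Proof.
case: ig => /integrable_norm gr /integrable_norm gi.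
apply: rintegrable_le (rintegrableD gr gi) _; first exact: measurable_cmod.
by move=> t /=; rewrite ger0_norm ?cmod_ge0// cmod_le_ReIm.
Qed.

Lemma measurable_chirp (c d : R) :
  measurable_fun setT (fun t : R => - (c * t) - d * t ^+ 2).
Proof.
by apply: measurable_funB; [apply: measurable_funN|];
  apply: measurable_funM => //; exact: measurable_funX.
Qed.

Lemma cintegrable_pft (eta lambda : R) :
  cintegrable (fun t => g t * expi (- (2 * pi * eta * t) - pi * lambda * t ^+ 2)).
Proof.
apply: cintegrable_le rintegrable_cmod _.
  by apply: cmeasurableM => //; apply: cmeasurable_expi; exact: measurable_chirp.
by move=> t; rewrite ComplexField.Normc.normcM cmod_expi mulr1.
Qed.

Hypothesis g1 : cintegral g = 1.

(** The transform at 0 is the integral of g, and the chirp moves it by at most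
    the integral of |g| times the phase |2 pi eta t + pi lambda t^2|. *)
Lemma pft_near1 (eta lambda : R) : rintegrable (moment_density g 1) ->
  rintegrable (moment_density g 2) ->
  cmod (pft g eta lambda - 1) <=
  2 * pi * `|eta| * moment g 1 + pi * `|lambda| * moment g 2.
Proof.
move=> i1 i2.
have -> : pft g eta lambda - 1 = cintegral (fun t =>
    g t * expi (- (2 * pi * eta * t) - pi * lambda * t ^+ 2) + (- 1) * g t).
  rewrite cintegralD ?cintegralZ//.
  - by rewrite g1 mulr1.
  - exact: cintegrable_pft.
  - exact: cintegrableZ.
rewrite -!RintegralZl// -RintegralD//; [|exact: rintegrableZ..].
apply: cmod_cintegral_le.
- by apply: cintegrableD; [exact: cintegrable_pft|exact: cintegrableZ].
- by apply: rintegrableD; exact: rintegrableZ.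
move=> t; set e := expi _.
have -> : g t * e + -1 * g t = g t * (e - 1) by ring.
rewrite ComplexField.Normc.normcM /moment_density.
apply: (le_trans (ler_wpM2l (cmod_ge0 _) (cmod_expiB1_le _))).
have -> : 2 * pi * `|eta| * (cmod (g t) * `|t| ^+ 1) +
    pi * `|lambda| * (cmod (g t) * `|t| ^+ 2) =
  cmod (g t) * (`|2 * pi * eta * t| + `|pi * lambda * t ^+ 2|).
  rewrite !normrM (ger0_norm (pi_ge0 R)) ger0_norm//.
  by ring.
by rewrite ler_wpM2l ?cmod_ge0// (le_trans (ler_normB _ _))// normrN.
Qed.

Lemma pft_le1 (eta lambda : R) : (forall t, 0 <= g t) ->
  cmod (pft g eta lambda) <= 1.
Proof.
move=> g0; apply: (@le_trans _ _ (\int[mu]_t cmod (g t))).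
  apply: cmod_cintegral_le; [exact: cintegrable_pft|exact: rintegrable_cmod|].
  by move=> t; rewrite ComplexField.Normc.normcM cmod_expi mulr1.
have -> : 1 = \int[mu]_t complex.Re (g t) :> R.
  by rewrite -[RHS]/(complex.Re (cintegral g)) g1.
rewrite le_eqVlt; apply/orP; left; apply/eqP; apply: eq_Rintegral => t _.
have := g0 t; rewrite lecE => /andP[/eqP] /=; case: (g t) => u v /= -> u0.
by rewrite expr0n/= addr0 sqrtr_sqr ger0_norm.
Qed.

End WindowTransform.

(** * The transform as a superposition of polynomial Fourier transforms *)

Section Approximation.
Context {R : realType}.

Lemma class_C3_measurable (phi : R -> R) :
  class_C3 phi -> measurable_fun setT phi.
Proof.
move=> [dphi _]; apply: continuous_measurable_fun => t.
by apply: differentiable_continuous; apply/derivable1_diffP; exact: (dphi 0%N).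
Qed.

Lemma cmeasurable_component (A phi : R -> R) : measurable_fun setT A ->
  measurable_fun setT phi -> cmeasurable (component A phi).
Proof.
move=> mA mphi; apply: cmeasurableM; first exact: cmeasurable_real.
by apply: cmeasurable_expi; exact: measurable_funM.
Qed.

Lemma cmeasurable_comp (f : R -> R[i]) (h : R -> R) : cmeasurable f ->
  measurable_fun setT h -> cmeasurable (fun t => f (h t)).
Proof.
move=> [fr fi] mh.
by split; [exact: (measurableT_comp fr)|exact: (measurableT_comp fi)].
Qed.

(** After the substitution t = sigma s, the transform of each local model is
    exactly a value of the polynomial Fourier transform of g, because its phase is
    quadratic and merges with the chirp.  The error is the integral of the local
    model remainder, with |t| = a sigma |s| producing the powers of a sigma and
    the moments of order 1 and 3. *)
Lemma tscr_approx (eps1 eps3 : R) (n : nat) (A phi : 'I_n.+1 -> R -> R)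
    (mu : R) (sigma : R -> R) (g : R -> R[i]) (a b lambda : R) :
  in_signal_class eps1 eps3 A phi -> cintegrable g ->
  rintegrable (moment_density g 1) -> rintegrable (moment_density g 3) ->
  0 < sigma b -> 0 < a ->
  cmod (tscr g mu sigma (signal A phi) a b lambda -
    \sum_k component (A k) (phi k) b *
      pft g (sigma b * (mu - a * (phi k)^`()%classic b))
            (sigma b ^+ 2 * a ^+ 2 * (lambda - (phi k)^`(2)%classic b)))
  <= amp_sum A b * (eps1 * sigma b * a * moment g 1 +
                    pi / 3 * eps3 * sigma b ^+ 3 * a ^+ 3 * moment g 3).
Proof.
move=> hx ig i1 i3 s0 a0; set s := sigma b in s0 *.
have mA k : measurable_fun setT (A k).
  by case: (hx k) => -[+ _ _] _; rewrite inE => /andP[/[!inE]].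
have mphi k : measurable_fun setT (phi k).
  by apply: class_C3_measurable; case: (hx k) => -[].
(* P k integrates to the polynomial Fourier transform seen by component k; F is
   the integrand of the transform after the substitution; D is their mismatch,
   dominated by M(b) r.  The integrability of F is deduced from that of D. *)
pose P k t := g t * expi (- (2 * pi * (s * (mu - a * (phi k)^`()%classic b)) * t)
  - pi * (s ^+ 2 * a ^+ 2 * (lambda - (phi k)^`(2)%classic b)) * t ^+ 2).
have iP k : cintegrable (P k) by exact: cintegrable_pft.
pose c k := component (A k) (phi k) b.
pose e t := expi (- (2 * pi * mu * s * t) - pi * lambda * a ^+ 2 * s ^+ 2 * t ^+ 2).
pose F t := signal A phi (b + a * s * t) * (g t * e t).
pose D t := F t + (- 1) * (\sum_k c k * P k t).
have mF : cmeasurable F.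
  apply: cmeasurableM; last first.
    apply: cmeasurableM; first exact: cintegrable_cmeasurable.
    by apply: cmeasurable_expi; exact: measurable_chirp.
  apply: (cmeasurable_comp (f := signal A phi)); last first.
    by apply: measurable_funD => //; exact: measurable_funM.
  by apply: cmeasurable_sum => k; exact: cmeasurable_component.
have iS := cintegrable_sum c iP.
pose r t := eps1 * s * a * moment_density g 1 t +
   pi / 3 * eps3 * s ^+ 3 * a ^+ 3 * moment_density g 3 t.
have ir : rintegrable r by apply: rintegrableD; exact: rintegrableZ.
have Dr t : cmod (D t) <= amp_sum A b * r t.
  have -> : D t = \sum_k (component (A k) (phi k) (b + a * s * t) -
     component (A k) (phi k) b * expi (2 * pi * (phi k)^`()%classic b * (a * s * t)
       + pi * (phi k)^`(2)%classic b * (a * s * t) ^+ 2)) * (g t * e t).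
    rewrite /D /F /signal mulr_suml mulr_sumr -big_split; apply: eq_bigr => k _.
    rewrite mulrBl mulN1r; congr (_ - _).
    rewrite /P /c /e -[RHS]mulrA; congr (_ * _).
    by rewrite [RHS]mulrCA -[in RHS]expiD; congr (_ * expi _); ring.
  apply: (le_trans (cmod_sum_le _ _)); rewrite /amp_sum mulr_suml.
  apply: ler_sum => k _; rewrite ComplexField.Normc.normcM.
  case: (hx k) => -[_ hA hphi] [_ _ hA1 hphi3].
  have := component_remainder hphi hphi3 (ltW (hA b)) (hA1 b (a * s * t)).
  move=> /(ler_wpM2r (cmod_ge0 (g t * e t))) /le_trans; apply.
  rewrite ComplexField.Normc.normcM cmod_expi mulr1 /r /moment_density.
  rewrite !normrM (gtr0_norm a0) (gtr0_norm s0).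
  by rewrite le_eqVlt; apply/orP; left; apply/eqP; ring.
have iD : cintegrable D.
  apply: cintegrable_le (rintegrableZ _ ir) Dr.
  apply: cmeasurableD => //; apply: cmeasurableM; first exact: cmeasurable_cst.
  apply: cmeasurable_sum => k; apply: cmeasurableM; first exact: cmeasurable_cst.
  exact: cintegrable_cmeasurable.
have FE : F = (fun t => D t + \sum_k c k * P k t).
  by apply/funext => t; rewrite /D mulN1r subrK.
have iF : cintegrable F by rewrite FE; exact: cintegrableD.
have -> : tscr g mu sigma (signal A phi) a b lambda = cintegral F.
  rewrite -(cintegral_dilation s0 iF) /tscr; congr cintegral; apply/funext => t.
  rewrite -/s; have s1 : s != 0 by rewrite gt_eqF.
  have -> : b + a * t = b + a * s * (t / s) by field.
  set x := signal _ _ _.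
  have -> : expi (- (2 * pi * mu * t) - pi * lambda * a ^+ 2 * t ^+ 2) = e (t / s).
    by rewrite /e; congr expi; field.
  by rewrite /F -/x; ring.
rewrite [in cintegral _]FE cintegralD// cintegral_sum// addrK.
apply: (le_trans (cmod_cintegral_le iD (rintegrableZ _ ir) Dr)).
rewrite RintegralZl// /r RintegralD//; [|exact: rintegrableZ..].
by rewrite !RintegralZl.
Qed.

End Approximation.

(** * Admissible windows and finiteness of the moments *)

Section Profile.
Context {R : realType}.

(** When y is not a value of h the right-hand side is +oo; otherwise y = h x and
    x is the inverse value, and x < u would give h u < y. *)
Lemma le_profile_inv (h : R -> R) (u y : R) : decreasing_profile h ->
  0 <= u -> y <= h u -> (u%:E <= profile_inv h y)%E.
Proof.
move=> [hdec _ _ _] u0 yu; rewrite /profile_inv; case: ifPn => [|_]; last exact: leey.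
rewrite inE => -[x /= x0 hxy]; rewrite in_itv/= andbT in x0.
rewrite -hxy pinvKV ?inE/= ?in_itv/= ?andbT//; last first.
  move=> v w; rewrite !inE/= !in_itv/= !andbT => v0 w0 hvw.
  apply/eqP; case: ltgtP => // vw.
  - by have := hdec _ _ v0 vw; rewrite hvw ltxx.
  - by have := hdec _ _ w0 vw; rewrite hvw ltxx.
rewrite lee_fin leNgt; apply/negP => xu.
by have := hdec _ _ x0 xu; rewrite hxy ltNge yu.
Qed.

End Profile.

Section FiniteMoments.
Context {R : realType}.
Local Open Scope ereal_scope.

Lemma abs_moment_ge0 (g : R -> R[i]) m : 0 <= abs_moment g m.
Proof. by apply: integral_ge0 => t _; rewrite lee_fin cmod_ge0. Qed.

Lemma lty_posM (c : R) (x : \bar R) : (0 < c)%R -> c%:E * x < +oo -> x < +oo.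
Proof. by move=> c0; case: x => // [r _|]; rewrite ?ltry// gt0_muley. Qed.

Lemma lty_addl (x y : \bar R) : 0 <= y -> x + y < +oo -> x < +oo.
Proof. by case: x y => [x||] [y||]//; rewrite ?ltry. Qed.

(** Both moments enter the error with positive coefficients, while the remaining
    terms of the error cannot be -oo. *)
Lemma Err_lty_moments (eps1 eps3 : R) (g : R -> R[i]) (mu Delta : R)
    (sigma : R -> R) (n : nat) (A phi : 'I_n.+1 -> R -> R)
    (Upslk : 'I_n.+1 -> 'I_n.+1 -> R -> R) (l : 'I_n.+1) (b : R) :
  (0 < eps1)%R -> (0 < eps3)%R -> (0 < sigma b)%R ->
  (0 < amp_sum A b)%R -> (0 < (mu + Delta) / (phi l)^`()%classic b)%R ->
  Err eps1 eps3 g mu Delta sigma A phi Upslk l b < +oo ->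
  abs_moment g 1 < +oo /\ abs_moment g 3 < +oo.
Proof.
move=> e1 e3 s0 M0 q0; rewrite /Err.
set S := (\sum_(k < n.+1 | k != l) _)%R.
have -> x : x + S%:E < +oo = (x < +oo) by case: x => //= r; rewrite !ltry.
move=> /(lty_posM M0); rewrite /Pil /Pi_at => H.
have c1 : (0 < eps1 * sigma b * ((mu + Delta) / (phi l)^`()%classic b))%R.
  by rewrite mulr_gt0// mulr_gt0.
have c3 : (0 < pi / 3 * eps3 * sigma b ^+ 3 *
    ((mu + Delta) / (phi l)^`()%classic b) ^+ 3)%R.
  rewrite mulr_gt0 ?exprn_gt0// mulr_gt0 ?exprn_gt0// mulr_gt0//.
  by rewrite divr_gt0 ?pi_gt0.
split.
- apply: (lty_posM c1); apply: lty_addl H.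
  by rewrite mule_ge0 ?abs_moment_ge0// lee_fin ltW.
- apply: (lty_posM c3); rewrite addeC in H; apply: lty_addl H.
  by rewrite mule_ge0 ?abs_moment_ge0// lee_fin ltW.
Qed.

End FiniteMoments.

Lemma window_cintegrable (R : realType) (g : R -> R[i]) :
  window g -> cintegrable g.
Proof. by move=> [[gr gi _ _] _]; split; apply/Lfun1_integrable. Qed.

(** Were the first moment zero, [pft_near1] would make the polynomial Fourier
    transform of g equal to 1 at (1, 0); admissibility with c = 0 would then give
    1 <= beta(1), but beta decreases strictly from beta(0) = 1. *)
Lemma admissible_moment1_gt0 (R : realType) (g : R -> R[i]) (c0 : R)
    (beta gamma : R -> R) : admissible g c0 beta gamma ->
  rintegrable (moment_density g 1) -> rintegrable (moment_density g 3) ->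
  0 < moment g 1.
Proof.
move=> [hw /andP[c00 _] [bdec _ _ b0] _ [f [hf hfc]]] i1 i3.
have ig := window_cintegrable hw; have [_ [_ _ g1]] := hw.
have i2 := rintegrable_moment2 (cintegrable_cmeasurable ig) i1 i3.
rewrite lt_neqAle moment_ge0 andbT; apply/negP => /eqP J1.
have := pft_near1 ig g1 1 0 i1 i2.
rewrite -J1 normr0 !mulr0 mul0r addr0 => d0.
have p1 : pft g 1 0 = 1.
  apply/eqP; rewrite -subr_eq0; apply/eqP/ComplexField.Normc.eq0_normc.
  by apply/eqP; rewrite eq_le d0 cmod_ge0.
have := hf 1 0; rewrite p1 ComplexField.Normc.normc1 normr1 normr0 => f1.
have [| |] := hfc 0 1 0 _ ler01 (lexx _) _.
- by rewrite lexx ltW.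
- by rewrite -f1 subr0.
by rewrite subr0 => b1 _; have := bdec 0 1 (lexx _) ltr01; rewrite b0 ltNge b1.
Qed.

(** * Ridges of the transform at a fixed time *)

Section FixedTime.
Context {R : realType}.
Variables (eps1 eps3 : R) (n : nat) (A phi : 'I_n.+1 -> R -> R).
Variables (mu : R) (sigma : R -> R) (g : R -> R[i]) (Delta Delta1 : R).
Variables (a1 a2 Ups : R -> R) (Upslk : 'I_n.+1 -> 'I_n.+1 -> R -> R) (b : R).
Hypotheses (heps1 : 0 < eps1) (heps3 : 0 < eps3).
Hypothesis hx : in_signal_class eps1 eps3 A phi.
Hypotheses (hmu : 0 < mu) (hs : 0 < sigma b).
Hypotheses (hDelta : 0 < Delta) (hDelta1 : 0 < Delta1) (ha1 : 0 < a1 b <= a2 b).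
Hypothesis hscales : forall (k : 'I_n.+1) (a : R), 0 < a ->
  `|mu - a * (phi k)^`()%classic b| < Delta -> scales a1 a2 b a.
Hypothesis hUps : Upsilon_spec g mu Delta Delta1 sigma a1 a2 phi Ups Upslk.
Hypotheses (ig : cintegrable g) (g1 : cintegral g = 1).
Hypotheses (i1 : rintegrable (moment_density g 1))
  (i3 : rintegrable (moment_density g 3)).

Local Notation freq k := ((phi k)^`()%classic b).
Local Notation rate k := ((phi k)^`(2)%classic b).
Local Notation U := (tscr g mu sigma (signal A phi)).
Local Notation M := (amp_sum A b).
Local Notation x_ k := (component (A k) (phi k) b).
Local Notation gain k a lambda :=
  (pft g (sigma b * (mu - a * freq k)) (sigma b ^+ 2 * a ^+ 2 * (lambda - rate k))).

(** The real-valued counterparts of [Pi_at], of the cross terms and of [Err], for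
    a window with finite moments. *)
Definition scale_err (a : R) : R := eps1 * sigma b * a * moment g 1 +
  pi / 3 * eps3 * sigma b ^+ 3 * a ^+ 3 * moment g 3.

Definition leakage (l : 'I_n.+1) : R :=
  \sum_(k < n.+1 | k != l) A k b * Upslk l k b.

Definition real_Err (l : 'I_n.+1) : R :=
  M * scale_err ((mu + Delta) / freq l) + leakage l.

Lemma A_gt0 k : 0 < A k b.
Proof. by case: (hx k) => -[_ + _] _; apply. Qed.

Lemma freq_gt0 k : 0 < freq k.
Proof.
case: (hx k) => _ [+ _ _ _] => h0; rewrite -lte_fin; apply: (lt_le_trans h0).
by apply: ereal_inf_lbound; exists b.
Qed.

Lemma amp_sum_gt0 : 0 < M.
Proof.
rewrite /amp_sum (bigD1 ord0)//= ltr_pwDl ?A_gt0//.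
by apply: sumr_ge0 => k _; rewrite ltW ?A_gt0.
Qed.

Lemma cmod_component k : cmod (x_ k) = A k b.
Proof.
by rewrite ComplexField.Normc.normcM cmod_expi mulr1 cmod_real gtr0_norm ?A_gt0.
Qed.

Lemma Pi_atE a : Pi_at eps1 eps3 g (sigma b) a = (scale_err a)%:E.
Proof. by rewrite /Pi_at !abs_momentE. Qed.

Lemma ErrE l :
  Err eps1 eps3 g mu Delta sigma A phi Upslk l b = (real_Err l)%:E.
Proof. by rewrite /Err /Pil Pi_atE. Qed.

Lemma cubic_coef_ge0 : 0 <= pi / 3 * eps3 * sigma b ^+ 3.
Proof. by rewrite mulr_ge0 ?exprn_ge0 ?ltW// mulr_gt0// divr_gt0 ?pi_gt0. Qed.

Lemma scale_err_le a a' : 0 <= a -> a <= a' -> scale_err a <= scale_err a'.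
Proof.
move=> a0 aa'; have a'0 := le_trans a0 aa'.
rewrite /scale_err lerD// ler_wpM2r ?moment_ge0//.
  by rewrite ler_wpM2l// mulr_ge0 ?ltW.
by rewrite ler_wpM2l ?cubic_coef_ge0// lerXn2r.
Qed.

Lemma scale_err_lt a a' : 0 < moment g 1 -> 0 <= a -> a < a' ->
  scale_err a < scale_err a'.
Proof.
move=> J1 a0 aa'; have a'0 := le_trans a0 (ltW aa').
rewrite /scale_err ltr_leD//.
  by rewrite ltr_pM2r// ltr_pM2l// mulr_gt0.
rewrite ler_wpM2r ?moment_ge0// ler_wpM2l ?cubic_coef_ge0// lerXn2r//.
exact: ltW.
Qed.

Lemma gain_zone_le (l k : 'I_n.+1) (a lambda : R) : k != l ->
  zone mu Delta Delta1 a1 a2 (phi l) (a, b, lambda) ->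
  cmod (gain k a lambda) <= Upslk l k b.
Proof.
move=> kl az; have [_ _ /(_ _ _ kl) H] := hUps b.
rewrite -lee_fin; apply: le_trans H.
by apply: ereal_sup_ubound; exists (a, lambda).
Qed.

(** Inside the zone of component l, the other terms of the superposition of
    [tscr_approx] are bounded by the leakage into that zone. *)
Lemma zone_approx (l : 'I_n.+1) (a lambda : R) : 0 < a ->
  zone mu Delta Delta1 a1 a2 (phi l) (a, b, lambda) ->
  cmod (U a b lambda - x_ l * gain l a lambda) <= M * scale_err a + leakage l.
Proof.
move=> a0 az; have := tscr_approx mu lambda hx ig i1 i3 hs a0.
rewrite (bigD1 l)//; set S := \sum_(k | k != l) _ => H.
have tri (u v w : R[i]) : cmod (u - v) <= cmod (u - (v + w)) + cmod w.
  have -> : u - v = u - (v + w) + w by rewrite opprD addrA subrK.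
  exact: (cmodD_le (u - (v + w)) w).
apply: (le_trans (tri _ _ S)); apply: lerD => //.
apply: (le_trans (cmod_sum_le _ _)); apply: ler_sum => k kl.
rewrite ComplexField.Normc.normcM cmod_component.
by rewrite ler_wpM2l ?gain_zone_le// ltW ?A_gt0.
Qed.

(** A scale in the zone of component l satisfies a phi_l' < mu + Delta. *)
Lemma zone_approx_Err (l : 'I_n.+1) (a lambda : R) : 0 < a ->
  zone mu Delta Delta1 a1 a2 (phi l) (a, b, lambda) ->
  cmod (U a b lambda - x_ l * gain l a lambda) <= real_Err l.
Proof.
move=> a0 az; apply: (le_trans (zone_approx a0 az)).
rewrite lerD2r ler_wpM2l ?(ltW amp_sum_gt0)//; apply: scale_err_le; first exact: ltW.
rewrite ler_pdivlMr ?freq_gt0//; case: az => _ + _.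
rewrite ltr_norml => /andP[+ _].
by rewrite ltrBrDr addrC ltrBlDr => /ltW; rewrite addrC.
Qed.

Lemma ridge_in_zone (l : 'I_n.+1) :
  zone mu Delta Delta1 a1 a2 (phi l) (mu / freq l, b, rate l).
Proof.
have f0 := freq_gt0 l.
have D0 : `|mu - mu / freq l * freq l| < Delta.
  by rewrite divfK ?gt_eqF// subrr normr0.
split => //; last by rewrite subrr normr0.
by apply: hscales D0; rewrite divr_gt0.
Qed.

Lemma gain_ridge (l : 'I_n.+1) : gain l (mu / freq l) (rate l) = 1.
Proof.
rewrite divfK ?gt_eqF ?freq_gt0// !subrr !mulr0 -g1 /pft; congr cintegral.
by apply/funext => t; rewrite !(mulr0, mul0r, oppr0, addr0) expi0 mulr1.
Qed.

Lemma ridge_lower_bound (l : 'I_n.+1) :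
  A l b - (M * scale_err (mu / freq l) + leakage l) <=
  cmod (U (mu / freq l) b (rate l)).
Proof.
have a0 : 0 < mu / freq l by rewrite divr_gt0 ?freq_gt0.
have := zone_approx a0 (ridge_in_zone l); rewrite gain_ridge mulr1 => H.
rewrite lerBlDr -[leLHS]cmod_component.
have -> : x_ l = U (mu / freq l) b (rate l) + - (U (mu / freq l) b (rate l) - x_ l).
  by ring.
by rewrite (le_trans (cmodD_le _ _))// lerD2l cmodN.
Qed.

(** A supremum over the complement of the zones is nonnegative because this
    complement is nonempty: it contains every chirp rate that exceeds all the
    phi_k'' by Delta1. *)
Lemma Ups_ge0 : 0 <= Ups b.
Proof.
have [_ /(_ ord0) H _] := hUps b.
pose lam := Delta1 + \sum_(k < n.+1) `|rate k|.
rewrite -lee_fin; apply: le_trans H.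
apply: (@le_trans _ _ (comp_gain g mu sigma (phi ord0) (a1 b) b lam)%:E).
  by rewrite lee_fin cmod_ge0.
apply: ereal_sup_ubound; exists (a1 b, lam) => //=; split.
  by case/andP: ha1 => _ ?; rewrite /scales/= lexx.
case=> k _ [_ _]; apply/negP; rewrite -leNgt.
apply: le_trans (ler_norm _); rewrite /lam (bigD1 k)//= -[leLHS]addr0 -!addrA lerD2l.
by rewrite addrCA addr_ge0 ?sumr_ge0// subr_ge0 ler_norm.
Qed.

Lemma Upslk_ge0 (l k : 'I_n.+1) : k != l -> 0 <= Upslk l k b.
Proof.
by move=> kl; apply: le_trans (gain_zone_le kl (ridge_in_zone l)); exact: cmod_ge0.
Qed.

Lemma leakage_ge0 l : 0 <= leakage l.
Proof.
by apply: sumr_ge0 => k kl; rewrite mulr_ge0 ?Upslk_ge0// ltW ?A_gt0.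
Qed.

Lemma leakage_le l : leakage l <= M * Ups b.
Proof.
rewrite /leakage /amp_sum mulr_suml [leRHS](bigD1 l)//= ler_wpDl//.
  by rewrite mulr_ge0 ?Ups_ge0// ltW ?A_gt0.
apply: ler_sum => k kl; rewrite ler_wpM2l ?(ltW (A_gt0 k))//.
by have [H _ _] := hUps b; exact: H.
Qed.

(** The whole window of scales |mu - a phi_l'| < Delta is at most a2, and mu / phi_l'
    is its centre. *)
Lemma ridge_scale_lt (l : 'I_n.+1) : mu / freq l < a2 b.
Proof.
have f0 := freq_gt0 l.
have : scales a1 a2 b ((mu + Delta / 2) / freq l).
  apply: (hscales (k := l)); first by rewrite divr_gt0// addr_gt0// divr_gt0.
  rewrite divfK ?gt_eqF// opprD addrA subrr sub0r normrN gtr0_norm ?divr_gt0//.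
  by rewrite ltr_pdivrMr// ltr_pMr// ltr1n.
case/andP => _; apply: lt_le_trans.
by rewrite ltr_pM2r ?invr_gt0// ltrDl divr_gt0.
Qed.

(** The inequality is strict because the error at the ridge scale is strictly
    smaller than the error at a2. *)
Lemma ridge_above_threshold (l : 'I_n.+1) (thr : R) : 0 < moment g 1 ->
  thr <= amp_min A b - M * (Ups b + scale_err (a2 b)) ->
  thr < cmod (U (mu / freq l) b (rate l)).
Proof.
move=> J1 hthr; apply: (le_lt_trans hthr).
apply: lt_le_trans (ridge_lower_bound l).
have Al : amp_min A b <= A l b by exact: bigmin_le.
rewrite ler_ltB// [ltRHS]mulrDr [ltRHS]addrC ltr_leD ?leakage_le//.
rewrite ltr_pM2l ?amp_sum_gt0// scale_err_lt ?ridge_scale_lt//.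
by rewrite ltW// divr_gt0 ?freq_gt0.
Qed.

Lemma real_Err_ge0 l : 0 <= real_Err l.
Proof.
rewrite /real_Err addr_ge0 ?leakage_ge0// mulr_ge0 ?(ltW amp_sum_gt0)//.
have q0 : 0 <= (mu + Delta) / freq l by rewrite ltW// divr_gt0 ?addr_gt0 ?freq_gt0.
rewrite /scale_err addr_ge0// mulr_ge0 ?moment_ge0// mulr_ge0 ?exprn_ge0//.
- by rewrite mulr_ge0 ?ltW.
- exact: cubic_coef_ge0.
Qed.

(** The estimates at a maximum use only that it lies in the zone and that the
    transform is at least as large there as at the ridge point. *)
Section Peak.
Variables (l : 'I_n.+1) (a lambda : R).
Hypotheses (a0 : 0 < a) (az : zone mu Delta Delta1 a1 a2 (phi l) (a, b, lambda)).
Hypothesis peak : cmod (U (mu / freq l) b (rate l)) <= cmod (U a b lambda).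

Lemma peak_ge : A l b - real_Err l <= cmod (U a b lambda).
Proof.
apply: le_trans peak; apply: le_trans (ridge_lower_bound l).
rewrite lerD2l lerN2 lerD2r ler_wpM2l ?(ltW amp_sum_gt0)//.
apply: scale_err_le; first by rewrite ltW// divr_gt0 ?freq_gt0.
by rewrite ler_wpM2r ?invr_ge0 ?(ltW (freq_gt0 l))// lerDl ltW.
Qed.

Lemma peak_le : cmod (U a b lambda) <= A l b * cmod (gain l a lambda) + real_Err l.
Proof.
rewrite -lerBlDl; apply: le_trans (zone_approx_Err a0 az).
apply: le_trans (cmodB_ge _ _).
by rewrite ComplexField.Normc.normcM cmod_component.
Qed.

(** The lower and upper bounds for |U| at the maximum leave no room for a small
    gain: A_l - Err_l <= A_l |gain| + Err_l. *)
Lemma peak_gain_ge : 1 - 2 * real_Err l / A l b <= cmod (gain l a lambda).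
Proof.
have H := le_trans peak_ge peak_le; have Al := A_gt0 l.
rewrite -(ler_pM2l Al) mulrBr mulr1 [A l b * (_ / _)]mulrC divfK ?gt_eqF//.
by lra.
Qed.

Lemma peak_component_dist : cmod (U a b lambda - x_ l) <=
  real_Err l + A l b * cmod (gain l a lambda - 1).
Proof.
have tri (u v w : R[i]) : cmod (u - w) <= cmod (u - v) + cmod (v - w).
  have -> : u - w = u - v + (v - w) by rewrite addrA subrK.
  exact: (cmodD_le (u - v) (v - w)).
apply: (le_trans (tri _ (x_ l * gain l a lambda) _)).
apply: lerD; first exact: zone_approx_Err.
have -> : x_ l * gain l a lambda - x_ l = x_ l * (gain l a lambda - 1) by ring.
by rewrite ComplexField.Normc.normcM cmod_component.
Qed.

End Peak.

End FixedTime.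

(** * Estimation of the ridges and of the components *)

Theorem theorem2 (R : realType)
  (eps1 eps3 : R) (heps1 : 0 < eps1) (heps3 : 0 < eps3)
  (n : nat) (A phi : 'I_n.+1 -> R -> R)
  (hx : in_signal_class eps1 eps3 A phi)
  (mu : R) (hmu : 0 < mu)
  (sigma : R -> R) (hsigma : forall b : R, 0 < sigma b)
  (g : R -> R[i]) (c0 : R) (beta gamma : R -> R)
  (hg : admissible g c0 beta gamma)
  (Delta Delta1 : R) (hDelta : 0 < Delta < 1) (hDelta1 : 0 < Delta1)
  (a1 a2 : R -> R) (ha : forall b : R, 0 < a1 b <= a2 b)
  (hscales : forall (k : 'I_n.+1) (b a : R), 0 < a ->
     `|mu - a * (phi k)^`()%classic b| < Delta ->
     scales a1 a2 b a)
  (Ups : R -> R) (Upslk : 'I_n.+1 -> 'I_n.+1 -> R -> R)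
  (hUps : Upsilon_spec g mu Delta Delta1 sigma a1 a2 phi Ups Upslk)
  (hsep : forall k l : 'I_n.+1, k != l ->
     (forall t : R, Delta <= `|(phi k)^`()%classic t - (phi l)^`()%classic t| /
                         ((phi k)^`()%classic t + (phi l)^`()%classic t)) \/
     (forall t : R, 2 * Delta1 <=
                    `|(phi k)^`(2)%classic t - (phi l)^`(2)%classic t|))
  (epst : R -> R) (ahat lhat : 'I_n.+1 -> R -> R) (b : R) :
  let U := tscr g mu sigma (signal A phi) in
  let M := amp_sum A b in
  let nu := amp_min A b in
  let P0 := Pi0 eps1 eps3 g sigma a2 b in
  let E := fun l : 'I_n.+1 => Err eps1 eps3 g mu Delta sigma A phi Upslk l b in
  ((2 * M)%:E * ((Ups b)%:E + P0) <= nu%:E)%E ->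
  (forall l : 'I_n.+1, 2%:E * E l * ((A l b)^-1)%:E <= c0%:E)%E ->
  0 < epst b ->
  (M%:E * ((Ups b)%:E + P0) <= (epst b)%:E)%E ->
  ((epst b)%:E <= nu%:E - M%:E * ((Ups b)%:E + P0))%E ->
  (forall l : 'I_n.+1, is_argmax (Hsetk U a1 a2 epst mu Delta Delta1 (phi l) b)
               (fun p => cmod (U p.1 b p.2)) (ahat l b, lhat l b)) ->
  [/\ forall l : 'I_n.+1,
        (`|mu - ahat l b * (phi l)^`()%classic b|%:E
           <= Bd1 beta (sigma b) (E l) (A l b))%E /\
        (`|lhat l b - (phi l)^`(2)%classic b|%:E
           <= Bd2 gamma (sigma b) (ahat l b) (E l) (A l b))%E,
      forall l : 'I_n.+1,
        ((cmod (U (ahat l b) b (lhat l b) - component (A l) (phi l) b))%:E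
           <= Bd3 g beta gamma (E l) (A l b))%E
    & (forall t : R, 0 <= g t) ->
      forall l : 'I_n.+1,
        (`|cmod (U (ahat l b) b (lhat l b)) - A l b|%:E <= E l)%E].
Proof.
move=> U M nu P0 E _ hE _ _ hthr hmax.
have [hw _ hbeta hgamma [f [hf hfc]]] := hg.
have ig := window_cintegrable hw; have [_ [_ _ g1]] := hw.
have /andP[D0 _] := hDelta.
have Aq k : 0 < A k b := A_gt0 b hx k.
have fr k : 0 < (phi k)^`()%classic b := freq_gt0 b hx k.
(* An infinite moment would make Err infinite, against 2 Err / A <= c0. *)
have [i1 i3] : rintegrable (moment_density g 1) /\ rintegrable (moment_density g 3).
  have [|m1 m3] := @Err_lty_moments R eps1 eps3 g mu Delta sigma n A phi Upslk
      ord0 b heps1 heps3 (hsigma b) (amp_sum_gt0 b hx)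
      (divr_gt0 (addr_gt0 hmu D0) (fr ord0)).
    have := hE ord0; rewrite /E; case: (Err _ _ _ _ _ _ _ _ _ _ _) => //= [r _|].
      exact: ltry.
    by rewrite gt0_muley ?lte_fin// gt0_mulye ?lte_fin ?invr_gt0.
  have mg := cintegrable_cmeasurable ig.
  by split; exact: rintegrable_moment_density.
have i2 := rintegrable_moment2 (cintegrable_cmeasurable ig) i1 i3.
have J1 := admissible_moment1_gt0 hg i1 i3.
pose e l := real_Err eps1 eps3 A phi mu sigma g Delta Upslk b l.
have EE l : E l = (e l)%:E by exact: ErrE.
have e0 l : 0 <= e l by apply: (real_Err_ge0 heps1 heps3 hx hmu (hsigma b) D0
  hDelta1 (hscales ^~ b) hUps).
have hthrR : epst b <= nu - M * (Ups b + scale_err eps1 eps3 sigma g b (a2 b)).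
  by move: hthr; rewrite /P0 /Pi0 Pi_atE// -EFinD -EFinM -EFinB lee_fin.
have cE l : 0 <= 2 * e l / A l b <= c0.
  have := hE l; rewrite EE -!EFinM lee_fin => ->; rewrite andbT.
  by rewrite divr_ge0 ?mulr_ge0 ?e0 ?(ltW (Aq l)).
have fineE l : fine (E l) = e l by rewrite EE.
have az l : zone mu Delta Delta1 a1 a2 (phi l) (ahat l b, b, lhat l b).
  by case: (hmax l) => -[[]].
have a0 l : 0 < ahat l b.
  case: (az l) => /andP[+ _] _ _; apply: lt_le_trans.
  by case/andP: (ha b).
(* The ridge point competes in the maximization, as it lies in H_{b,l}. *)
have peak l : cmod (U (mu / (phi l)^`()%classic b) b ((phi l)^`(2)%classic b)) <=
              cmod (U (ahat l b) b (lhat l b)).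
  case: (hmax l) => _ /(_ (mu / (phi l)^`()%classic b, (phi l)^`(2)%classic b)).
  apply; have [? ? ?] := ridge_in_zone hx hmu D0 hDelta1 (hscales ^~ b) l.
  split => //; split => //.
  exact: (ridge_above_threshold heps1 heps3 hx hmu (hsigma b) D0 hDelta1 (ha b)
    (hscales ^~ b) hUps ig g1 i1 i3 l J1 hthrR).
pose eta l := sigma b * (mu - ahat l b * (phi l)^`()%classic b).
pose kap l := sigma b ^+ 2 * ahat l b ^+ 2 * (lhat l b - (phi l)^`(2)%classic b).
have gain_ge l : 1 - 2 * e l / A l b <= cmod (pft g (eta l) (kap l)).
  exact: (peak_gain_ge heps1 heps3 hx hmu (hsigma b) D0 hDelta1 (hscales ^~ b)
    hUps ig g1 i1 i3 (a0 l) (az l) (peak l)).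
have bounds l : (`|eta l|%:E <= profile_inv beta (1 - 2 * fine (E l) / A l b))%E /\
    (`|kap l|%:E <= profile_inv gamma (1 - 2 * fine (E l) / A l b))%E.
  rewrite fineE; have := gain_ge l; rewrite hf => /hfc[]// hb hc.
  by split; apply: le_profile_inv.
split => [l|l|g0 l].
- have s0 := hsigma b; have [hb hc] := bounds l; split.
  + rewrite /Bd1 lee_pdivlMl// -EFinM; apply: le_trans hb.
    by rewrite /eta normrM gtr0_norm.
  + have sa0 : 0 < sigma b ^+ 2 * ahat l b ^+ 2 by rewrite mulr_gt0 ?exprn_gt0.
    rewrite /Bd2 lee_pdivlMl// -EFinM; apply: le_trans hc.
    by rewrite /kap normrM gtr0_norm.
- rewrite /Bd3; have [] := bounds l.
  set ib := profile_inv beta _; set ic := profile_inv gamma _ => hb hc.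
  rewrite EE !abs_momentE//.
  apply: (@le_trans _ _ ((e l)%:E + (2 * pi * A l b)%:E * (moment g 1)%:E * `|eta l|%:E
      + (pi * A l b)%:E * (moment g 2)%:E * `|kap l|%:E)%E).
    rewrite -!EFinM -!EFinD lee_fin.
    have := peak_component_dist heps1 heps3 hx (hsigma b) hUps ig i1 i3
      (a0 l) (az l).
    move=> /le_trans; apply; rewrite -[leRHS]addrA; apply: lerD => //.
    have := pft_near1 ig g1 (eta l) (kap l) i1 i2.
    move=> /(ler_wpM2l (ltW (Aq l))) /le_trans; apply.
    by rewrite le_eqVlt; apply/orP; left; apply/eqP; ring.
  apply: leeD; [apply: leeD => //|]; apply: lee_wpmul2l => //;
    by rewrite -EFinM lee_fin !mulr_ge0 ?moment_ge0 ?pi_ge0 ?(ltW (Aq l)).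
- rewrite EE lee_fin ler_norml; apply/andP; split.
    rewrite lerBrDl.
    exact: (peak_ge heps1 heps3 hx hmu (hsigma b) D0 hDelta1 (hscales ^~ b)
      hUps ig g1 i1 i3 (peak l)).
  rewrite lerBlDl.
  apply: (le_trans (peak_le heps1 heps3 hx (hsigma b) hUps ig i1 i3 (a0 l) (az l))).
  by rewrite lerD2r ler_piMr ?pft_le1 ?(ltW (Aq l)).
Qed.
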